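(* Let $p\geq q\geq1$ be integers with $\gcd(p,q)=1$, let $M_{p,q}=\mathrm{SU}(2)^2/K_{p,q}$, and let $(g_o,H_o)$ be the $\mathrm{SU}(2)^2$-invariant Bismut Ricci flat pair on $M_{p,q}$ defined in the context. Then the $3$-form $H_o$ is $g_o$-harmonic but it is not parallel with respect to the Bismut connection $\nabla$ of $(g_o,H_o)$, i.e. $\nabla H_o\neq0$.
   Context: For a Riemannian manifold $(M,g)$ with Levi-Civita connection $\nabla^g$ and a $3$-form $H$, the Bismut connection of $(g,H)$ is the metric connection $\nabla$ defined by $g(\nabla_XY,Z)=g(\nabla^g_XY,Z)+\frac12H(X,Y,Z)$ for all vector fields $X,Y,Z$. A pair $(g,H)$ with $dH=0$ is Bismut Ricci flat if the Ricci tensor of $\nabla$ vanishes. The subgroup is $K_{p,q}=\{(\mathrm{diag}(z^p,z^{-p}),\mathrm{diag}(z^q,z^{-q})) : z\in\mathbb{C},|z|=1\}\subset \mathrm{SU}(2)^2$. In $\mathfrak{su}(2)$ put $$\mathsf{H}=\begin{pmatrix}\frac i2&0\\0&-\frac i2\end{pmatrix},\quad \mathsf{E}=\begin{pmatrix}0&\frac1{2\sqrt2}\\-\frac1{2\sqrt2}&0\end{pmatrix},\quad \mathsf{V}=\begin{pmatrix}0&\frac i{2\sqrt2}\\\frac i{2\sqrt2}&0\end{pmatrix},$$ and in $\mathfrak{su}(2)\oplus\mathfrak{su}(2)$ put $e_1=(q\mathsf{H},-p\mathsf{H})$, $e_2=(\mathsf{E},0)$, $e_3=(\mathsf{V},0)$,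 $e_4=(0,\mathsf{E})$, $e_5=(0,\mathsf{V})$. The span $\mathfrak{m}$ of $e_1,\dots,e_5$ is an $\mathrm{Ad}(K_{p,q})$-invariant complement of the Lie algebra of $K_{p,q}$ and is identified with the tangent space of $M_{p,q}$ at $eK_{p,q}$; invariant tensors on $M_{p,q}$ are identified with $\mathrm{Ad}(K_{p,q})$-invariant tensors on $\mathfrak{m}$. With $(e^1,\dots,e^5)$ the dual basis and $e^{ijk}=e^i\wedge e^j\wedge e^k$, the pair is, up to replacing $(g_o,H_o)$ by $(tg_o,tH_o)$ with a constant $t>0$, $$g_o=2(p^2+q^2)\,e^1\otimes e^1+\frac{q^2}{p^2+q^2}(e^2\otimes e^2+e^3\otimes e^3)+\frac{p^2}{p^2+q^2}(e^4\otimes e^4+e^5\otimes e^5),\qquad H_o=q\,e^{123}+p\,e^{145}.$$ *)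

(* Defs.v *)
From HB Require Import structures.
From mathcomp Require Import all_boot all_order all_algebra.
From mathcomp Require Import complex spectral.
From mathcomp Require Import all_classical all_reals all_analysis.

Set Implicit Arguments.
Unset Strict Implicit.
Unset Printing Implicit Defensive.

Import Order.TTheory GRing.Theory Num.Theory.
Import numFieldNormedType.Exports.

Local Open Scope classical_set_scope.
Local Open Scope ring_scope.

(* With the differential ['d] of normed spaces, and finite-dimensional [V],
   [smooth f] is the usual C^infty condition. *)
Fixpoint ndiff (R : realType) (V W : normedModType R) (n : nat) (f : V -> W)
    : Prop :=
  match n with
  | 0 => True
  | n'.+1 => (forall x, differentiable f x) /\
             (forall v, ndiff n' (fun x => 'd f x v))
  end.

Definition smooth (R : realType) (V W : normedModType R) (f : V -> W) : Prop :=
  forall n, ndiff n f.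

(* SU(2)^2 is placed in the real normed algebra [amb R] through the embedding
   A + iB |-> [[A, -B], [B, A]] of complex 2x2 matrices into real 4x4 ones, so
   that products, Lie brackets and derivatives are those of [amb R]. *)
Notation amb R := ('M[R]_4 * 'M[R]_4)%type.

Section SU2.
Context {R : realType}.
Implicit Types (a b : 'M[R[i]]_2) (u v w x : amb R).

Definition realify a : 'M[R]_4 :=
  block_mx (map_mx (@complex.Re R) a) (- map_mx (@complex.Im R) a)
           (map_mx (@complex.Im R) a) (map_mx (@complex.Re R) a).

Definition emb a b : amb R := (realify a, realify b).

Definition mx2 (x00 x01 x10 x11 : R[i]) : 'M[R[i]]_2 :=
  \matrix_(i, j) (if i == 0 then if j == 0 then x00 else x01
                  else if j == 0 then x10 else x11).

Definition SU2 : set 'M[R[i]]_2 := [set a | a \is unitarymx /\ \det a = 1].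

Definition G : set (amb R) :=
  [set x | exists a b, [/\ SU2 a, SU2 b & x = emb a b]].

Definition K (p q : nat) : set (amb R) :=
  [set k | exists z : R[i], `|z| = 1 /\
     k = emb (mx2 (z ^+ p) 0 0 (z ^- p)) (mx2 (z ^+ q) 0 0 (z ^- q))].

(* The elements of [realify @` SU2] are orthogonal matrices: on [G] this is the
   group inverse, extended smoothly to the ambient algebra. *)
Definition ginv x : amb R := (x.1^T, x.2^T).

Definition sH : 'M[R[i]]_2 := mx2 ('i / 2)%C 0 0 (- ('i / 2))%C.
Definition sE : 'M[R[i]]_2 :=
  mx2 0 ((2 * Num.sqrt 2)^-1)%:C%C (- (2 * Num.sqrt 2)^-1)%:C%C 0.
Definition sV : 'M[R[i]]_2 :=
  mx2 0 ('i / (2 * Num.sqrt 2)%:C)%C ('i / (2 * Num.sqrt 2)%:C)%C 0.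

(* A basis of su(2) + su(2): the entry 0 spans the Lie algebra of K_{p,q}, and
   the entries 1, ..., 5 are e_1, ..., e_5. *)
Definition frame (p q : nat) : 6.-tuple (amb R) :=
  [tuple emb (p%:R *: sH) (q%:R *: sH);
         emb (q%:R *: sH) (- p%:R *: sH);
         emb sE 0; emb sV 0; emb 0 sE; emb 0 sV].

Definition m_space (p q : nat) : {vspace amb R} := <<behead (frame p q)>>%VS.

(* For i = 1, ..., 5 this is e^i, extended by 0 on the Lie algebra of K_{p,q}. *)
Definition coframe (p q i : nat) v : R := coord (frame p q) (inord i) v.

(* The projection of su(2) + su(2) onto m along the Lie algebra of K_{p,q}. *)
Definition pr_m (p q : nat) v : amb R :=
  \sum_(1 <= i < 6) coframe p q i v *: (frame p q)`_i.

Definition wedge3 (p q i j k : nat) u v w : R :=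
  \det (\matrix_(r < 3, s < 3)
     coframe p q (nth 0 [:: i; j; k] r) (nth 0 [:: u; v; w] s)).

Definition g_o (p q : nat) u v : R :=
  let e i := coframe p q i in
  let N : R := p%:R ^+ 2 + q%:R ^+ 2 in
  2 * N * (e 1 u * e 1 v)
  + q%:R ^+ 2 / N * (e 2 u * e 2 v + e 3 u * e 3 v)
  + p%:R ^+ 2 / N * (e 4 u * e 4 v + e 5 u * e 5 v).

Definition H_o (p q : nat) u v w : R :=
  q%:R * wedge3 p q 1 2 3 u v w + p%:R * wedge3 p q 1 4 5 u v w.

End SU2.
Arguments G {R}.
Arguments K {R}.

(* Differential geometry of M = G/K, with G = SU(2)^2 and K = K_{p,q}.
   A function on M is a right K-invariant function on G, and a vector field on
   M is given by its horizontal lift to G, the right K-equivariant field X with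
   X(x) in x.m for x in G.  Both are restrictions of smooth maps on the ambient
   algebra, since G is a closed submanifold; their values outside G are
   irrelevant, and every identity below is required at points of G only. *)
Section Geometry.
Context {R : realType} (p q : nat).
Local Notation A := (amb R).

Definition sfun (f : A -> R) : Prop :=
  smooth f /\ (forall x k, G x -> K p q k -> f (x * k) = f x).

Definition vfield (X : A -> A) : Prop :=
  [/\ smooth X,
      (forall x, G x -> ginv x * X x \in m_space p q) &
      (forall x k, G x -> K p q k -> X (x * k) = X x * k)].

Definition deriv (X : A -> A) (f : A -> R) : A -> R := fun x => 'd f x (X x).

(* The lifts are vector fields on the vector space [A], with Lie bracket
   dY(X) - dX(Y).  This bracket is tangent to G along G, and its horizontal part
   is the lift of the bracket of X and Y on M. *)
Definition lie (X Y : A -> A) : A -> A := fun x =>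
  x * pr_m p q (ginv x * ('d Y x (X x) - 'd X x (Y x))).

(* Evaluation on vector fields of the G-invariant tensors with value g, H at
   the base point. *)
Definition ev2 (g : A -> A -> R) (X Y : A -> A) : A -> R :=
  fun x => g (ginv x * X x) (ginv x * Y x).

Definition ev3 (H : A -> A -> A -> R) (X Y Z : A -> A) : A -> R :=
  fun x => H (ginv x * X x) (ginv x * Y x) (ginv x * Z x).

Definition connection (D : (A -> A) -> (A -> A) -> A -> A) : Prop :=
  (forall X Y, vfield X -> vfield Y -> vfield (D X Y)) /\
  forall X Y Z f, vfield X -> vfield Y -> vfield Z -> sfun f ->
  forall x, G x ->
  [/\ D (fun y => X y + Y y) Z x = D X Z x + D Y Z x,
      D (fun y => f y *: X y) Z x = f x *: D X Z x,
      D X (fun y => Y y + Z y) x = D X Y x + D X Z x &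
      D X (fun y => f y *: Y y) x = deriv X f x *: Y x + f x *: D X Y x].

Definition metric_connection (g : A -> A -> R)
    (D : (A -> A) -> (A -> A) -> A -> A) : Prop :=
  connection D /\
  forall X Y Z, vfield X -> vfield Y -> vfield Z -> forall x, G x ->
  deriv X (ev2 g Y Z) x = ev2 g (D X Y) Z x + ev2 g Y (D X Z) x.

Definition torsion_free (D : (A -> A) -> (A -> A) -> A -> A) : Prop :=
  forall X Y, vfield X -> vfield Y -> forall x, G x ->
  D X Y x - D Y X x = lie X Y x.

Definition levi_civita (g : A -> A -> R)
    (D : (A -> A) -> (A -> A) -> A -> A) : Prop :=
  metric_connection g D /\ torsion_free D.

(* [B] is the Bismut connection of (g, H), [D] being the Levi-Civita one. *)
Definition bismut (g : A -> A -> R) (H : A -> A -> A -> R)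
    (D B : (A -> A) -> (A -> A) -> A -> A) : Prop :=
  connection B /\
  forall X Y Z, vfield X -> vfield Y -> vfield Z -> forall x, G x ->
  ev2 g (B X Y) Z x = ev2 g (D X Y) Z x + 2^-1 * ev3 H X Y Z x.

Definition cov3 (D : (A -> A) -> (A -> A) -> A -> A) (H : A -> A -> A -> R)
    (X Y Z W : A -> A) : A -> R := fun x =>
  deriv X (ev3 H Y Z W) x
  - ev3 H (D X Y) Z W x - ev3 H Y (D X Z) W x - ev3 H Y Z (D X W) x.

Definition parallel3 (D : (A -> A) -> (A -> A) -> A -> A)
    (H : A -> A -> A -> R) : Prop :=
  forall X Y Z W, vfield X -> vfield Y -> vfield Z -> vfield W ->
  forall x, G x -> cov3 D H X Y Z W x = 0.

Definition dform3 (H : A -> A -> A -> R) (X Y Z W : A -> A) : A -> R := fun x =>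
  deriv X (ev3 H Y Z W) x - deriv Y (ev3 H X Z W) x
  + deriv Z (ev3 H X Y W) x - deriv W (ev3 H X Y Z) x
  - ev3 H (lie X Y) Z W x + ev3 H (lie X Z) Y W x - ev3 H (lie X W) Y Z x
  - ev3 H (lie Y Z) X W x + ev3 H (lie Y W) X Z x - ev3 H (lie Z W) X Y x.

Definition closed3 (H : A -> A -> A -> R) : Prop :=
  forall X Y Z W, vfield X -> vfield Y -> vfield Z -> vfield W ->
  forall x, G x -> dform3 H X Y Z W x = 0.

Definition orthonormal_at (g : A -> A -> R) (E : 'I_5 -> A -> A) (x : A) : Prop :=
  forall i j, ev2 g (E i) (E j) x = (i == j)%:R.

(* The codifferential is (d^* H)(Y, Z) = - sum_i (D_{E_i} H)(E_i, Y, Z), for the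
   Levi-Civita connection D and an orthonormal frame E. *)
Definition coclosed3 (g : A -> A -> R) (D : (A -> A) -> (A -> A) -> A -> A)
    (H : A -> A -> A -> R) : Prop :=
  forall x (E : 'I_5 -> A -> A) Y Z, G x ->
  (forall i, vfield (E i)) -> orthonormal_at g E x -> vfield Y -> vfield Z ->
  - \sum_(i < 5) cov3 D H (E i) (E i) Y Z x = 0.

Definition harmonic3 (g : A -> A -> R) (D : (A -> A) -> (A -> A) -> A -> A)
    (H : A -> A -> A -> R) : Prop :=
  closed3 H /\ coclosed3 g D H.

End Geometry.

(* Main.v *)
From HB Require Import structures.
Require Import Defs.
From mathcomp Require Import all_boot all_order all_algebra.
From mathcomp Require Import complex spectral ring lra.
From mathcomp Require Import all_classical all_reals all_analysis.

Set Implicit Arguments.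
Unset Strict Implicit.
Unset Printing Implicit Defensive.

Import Order.TTheory GRing.Theory Num.Theory.
Import numFieldNormedType.Exports.

Local Open Scope classical_set_scope.
Local Open Scope ring_scope.

(**
A horizontal lift X is determined along G by its coordinates, those of
x^-1 X(x) in m, and the derivative of the coordinates of Y along X is
x^-1 dY(X) - xi eta, where xi and eta are the values of x^-1 X and x^-1 Y.  The
products xi eta leave su(2) + su(2), but they only enter antisymmetrised, as Lie
brackets.  Koszul's formula then gives the Levi-Civita connection as this
derivative plus the bilinear map nabla(xi, eta) = [xi, eta]_m / 2 + U(xi, eta),
so that dH and nabla H become polynomials in coordinates: closedness and
coclosedness are polynomial identities.  The Bismut connection has the further
term H(xi, eta, .)^sharp / 2, and at the base point
(nabla_{e_2} H)(e_3, e_4, e_5) = - t p q / (2 (p^2 + q^2)).  It is computed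
on the lifts of the fundamental vector fields of the action of G on G/K.
*)

(** * Differentiability on the ambient algebra *)

Section Smooth.
Context {R : realType}.
Implicit Types V W : normedModType R.

Lemma continuous_bigsum V W (I : Type) (r : seq I) (f : I -> V -> W) :
  (forall i, continuous (f i)) -> continuous (fun x => \sum_(i <- r) f i x).
Proof.
move=> fc; elim: r => [|i r IH] x.
  under [X in continuous_at _ X]funext do rewrite big_nil.
  exact: cst_continuous.
under [X in continuous_at _ X]funext do rewrite big_cons.
by apply: continuousD; [exact: fc | exact: IH].
Qed.

Lemma continuous_mxP m n V (f : V -> 'M[R]_(m, n)) :
  (forall i j, continuous (fun x => f x i j)) -> continuous f.
Proof.
move=> fc x.
rewrite (_ : f = fun x => \sum_i \sum_j f x i j *: delta_mx i j); last first.
  by apply/funext => y; exact: matrix_sum_delta.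
apply: continuous_bigsum => i {}x; apply: continuous_bigsum => j {}x.
by apply: continuousZr_tmp; exact: fc.
Qed.

Lemma amb_mul_continuous :
  continuous (fun z : amb R * amb R => z.1 * z.2).
Proof.
have H (l : amb R -> 'M[R]_4) : continuous l ->
    continuous (fun z : amb R * amb R => (l z.1 *m l z.2 : 'M[R]_4)).
  move=> lc; apply: continuous_mxP => i j.
  have -> : (fun z : amb R * amb R => (l z.1 *m l z.2 : 'M[R]_4) i j) =
      fun z => \sum_k l z.1 i k * l z.2 k j.
    by apply/funext => z; rewrite mxE.
  apply: continuous_bigsum => k z.
  have e (g : amb R * amb R -> amb R) a b : continuous g ->
     continuous (fun z => l (g z) a b).
    move=> gc y.
    apply: (@continuous_comp _ _ _ (fun z => l (g z))
      (fun M : 'M[R]_4 => M a b)).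
      by apply: continuous_comp; [exact: gc | exact: lc].
    exact: coord_continuous.
  have e1 : continuous (fun z : amb R * amb R => l z.1 i k).
    by apply: (e fst i k) => y; exact: cvg_fst.
  have e2 : continuous (fun z : amb R * amb R => l z.2 k j).
    by apply: (e snd k j) => y; exact: cvg_snd.
  exact: (continuousM (e1 z) (e2 z)).
have H1 : continuous (fst : amb R -> 'M[R]_4) by move=> y; exact: cvg_fst.
have H2 : continuous (snd : amb R -> 'M[R]_4) by move=> y; exact: cvg_snd.
by move=> z; exact: (cvg_pair (H _ H1 z) (H _ H2 z)).
Qed.

(** Finite dimension is what matters: expanding the argument on the matrix units of both factors
    writes [l] as a finite sum of entries times constant vectors. *)
Lemma amb_linear_continuous W (l : {linear amb R -> W}) : continuous l.
Proof.
have e : (l : amb R -> W) = fun x =>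
   \sum_i \sum_j x.1 i j *: l (delta_mx i j, 0) +
   \sum_i \sum_j x.2 i j *: l (0, delta_mx i j).
  apply/funext => x.
  have -> : x = (x.1, 0) + (0, x.2).
    by case: x => a b; congr pair; rewrite /= ?addr0 ?add0r.
  rewrite raddfD /=; congr (_ + _).
    pose h := fun a : 'M[R]_4 => l (a, 0).
    have hl : linear h.
      move=> k a b; rewrite /h -linearP; congr (l _); congr pair.
      by rewrite /= scaler0 addr0.
    pose hL : {linear 'M[R]_4 -> W} :=
      HB.pack h (GRing.isLinear.Build _ _ _ _ _ hl).
    rewrite addr0 -[LHS]/(hL x.1) {1}[x.1]matrix_sum_delta raddf_sum.
    apply: eq_bigr => i _; rewrite raddf_sum; apply: eq_bigr => j _.
    exact: (linearZ_LR hL).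
  pose h := fun a : 'M[R]_4 => l (0, a).
  have hl : linear h.
    move=> k a b; rewrite /h -linearP; congr (l _); congr pair.
    by rewrite /= scaler0 addr0.
  pose hL : {linear 'M[R]_4 -> W} :=
    HB.pack h (GRing.isLinear.Build _ _ _ _ _ hl).
  rewrite add0r -[LHS]/(hL x.2) {1}[x.2]matrix_sum_delta raddf_sum.
  apply: eq_bigr => i _; rewrite raddf_sum; apply: eq_bigr => j _.
  exact: (linearZ_LR hL).
have H (g : amb R -> 'M[R]_4) (h : 'I_4 -> 'I_4 -> W) : continuous g ->
    continuous (fun x => \sum_i \sum_j g x i j *: h i j).
  move=> gc; apply: continuous_bigsum => i; apply: continuous_bigsum => j x.
  have gij : {for x, continuous (fun x => g x i j)}.
    exact: (@continuous_comp _ _ _ g (fun M : 'M[R]_4 => M i j) x (gc x)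
      (@coord_continuous _ _ _ i j (g x))).
  exact: (continuousZr_tmp (a := h i j) gij).
have H1 : continuous (fst : amb R -> 'M[R]_4) by move=> y; exact: cvg_fst.
have H2 : continuous (snd : amb R -> 'M[R]_4) by move=> y; exact: cvg_snd.
rewrite e => x; exact: (continuousD (H _ _ H1 x) (H _ _ H2 x)).
Qed.

(* A separate constant: in the library the bilinear structure of [*%R] is the
   one of the scalar field. *)
Definition amb_mul (x y : amb R) : amb R := x * y.

Lemma amb_mul_bilinear :
  bilinear_for
    (GRing.Scale.Law.clone _ _ *:%R _) (GRing.Scale.Law.clone _ _ *:%R _)
    amb_mul.
Proof.
have A (k : R) (x y : amb R) : (k *: x) * y = k *: (x * y).
  by case: x y => [x1 x2] [y1 y2]; congr pair; rewrite /= scalerAl.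
have B (k : R) (x y : amb R) : x * (k *: y) = k *: (x * y).
  by case: x y => [x1 x2] [y1 y2]; congr pair; rewrite /= scalerAr.
by split=> [x k y z|x k y z]; rewrite /amb_mul /= ?mulrDl ?mulrDr ?A ?B.
Qed.

HB.instance Definition _ :=
  bilinear_isBilinear.Build R (amb R) (amb R) (amb R) _ _ amb_mul
    amb_mul_bilinear.

(** Leibniz rule for a noncommutative product: the derivative of a continuous bilinear map is
    composed with that of the pair [(f, g)], keeping the order of the factors. *)
Lemma is_diff_amb_mul V (f g df dg : V -> amb R) x :
  is_diff x f df -> is_diff x g dg ->
  is_diff x (fun y => f y * g y) (fun v => f x * dg v + df v * g x).
Proof.
move=> [fd fe] [gd ge].
have pd : differentiable (fun y => (f y, g y)) x by exact: differentiable_pair.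
have md : differentiable (fun z : amb R * amb R => z.1 * z.2) (f x, g x).
  apply: (differentiable_bilin (f := amb_mul)).
  exact: amb_mul_continuous.
apply: DiffDef.
  exact: (differentiable_comp (g := fun z : amb R * amb R => z.1 * z.2) pd md).
have bE := diff_bilin (f := amb_mul) (f x, g x) amb_mul_continuous.
have pE : 'd (fun y => (f y, g y)) x =
    (fun v => ('d f x v, 'd g x v)) :> (V -> _).
  exact: diff_pair.
apply: (etrans (diff_comp (g := fun z : amb R * amb R => z.1 * z.2) pd md)).
apply/funext => v.
rewrite -fe -ge.
apply: (etrans (congr1 (fun h => h _) bE)).
by rewrite pE.
Qed.

Lemma is_diff_linear V W (l : {linear V -> W}) x :
  continuous l -> is_diff x l l.
Proof.
by move=> lc; apply: DiffDef; [exact: linear_differentiable | exact: diff_lin].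
Qed.

Lemma ndiffW V W n (f : V -> W) : ndiff n.+1 f -> ndiff n f.
Proof.
elim: n f => [//|n IH] f [fd Hf]; split=> // v; apply: IH; exact: Hf.
Qed.

Lemma ndiff_cst V W n (c : W) : ndiff n (fun _ : V => c).
Proof.
elim: n c => // n IH c; split=> [x|v]; first exact: differentiable_cst.
rewrite (_ : (fun _ => _) = fun=> 0); first exact: IH.
by apply/funext => x; rewrite diff_cst.
Qed.

Lemma ndiff_linear V W n (l : {linear V -> W}) : continuous l -> ndiff n l.
Proof.
move=> lc; case: n => // n; split=> [x|v]; first exact: linear_differentiable.
rewrite (_ : (fun _ => _) = fun=> l v); first exact: ndiff_cst.
by apply/funext => x; rewrite diff_lin.
Qed.

Lemma ndiffD V W n (f g : V -> W) :
  ndiff n f -> ndiff n g -> ndiff n (fun x => f x + g x).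
Proof.
elim: n f g => [f g _ _|n IH f g [fd Hf] [gd Hg]]; first exact: I.
split=> [x|v].
  exact: differentiableD.
rewrite (_ : (fun _ => _) = fun x => 'd f x v + 'd g x v).
  by apply: IH; [exact: Hf | exact: Hg].
by apply/funext => x; rewrite diffD.
Qed.

(** Induction through Leibniz: the derivative is again a sum of products, each with one factor
    differentiated and the other kept; [ndiffW] lowers the order of the factor that is kept. *)
Lemma ndiff_mul V n (f g : V -> amb R) :
  ndiff n f -> ndiff n g -> ndiff n (fun x => f x * g x).
Proof.
elim: n f g => [|n IH] f g Hf Hg; first exact: I.
have D x : is_diff x (fun y => f y * g y)
    (fun v => f x * 'd g x v + 'd f x v * g x).
  by apply: is_diff_amb_mul; apply: DiffDef => //;
    [case: Hf => + _|case: Hg => + _]; exact.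
have h1 x := @ex_diff _ _ _ _ _ _ _ (D x).
have h2 x := @diff_val _ _ _ _ _ _ _ (D x).
split=> [|v]; first exact: h1.
rewrite (_ : (fun _ => _) = fun x => f x * 'd g x v + 'd f x v * g x).
  apply: ndiffD; apply: IH;
    [exact: ndiffW|exact: (proj2 Hg)|exact: (proj2 Hf)|exact: ndiffW].
apply/funext => x; exact: (congr1 (fun h => h v) (h2 x)).
Qed.

Lemma ndiff_linear_comp V V' W n (l : {linear V' -> W}) (f : V -> V') :
  continuous l -> ndiff n f -> ndiff n (fun x => l (f x)).
Proof.
move=> lc; elim: n f => [f _|n IH f [fd Hf]]; first exact: I.
have ld x : differentiable l x by exact: linear_differentiable.
split=> [x|v]; first exact: (differentiable_comp (fd x) (ld (f x))).
rewrite (_ : (fun _ => _) = fun x => l ('d f x v)).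
  by apply: IH; exact: Hf.
apply/funext => x; rewrite (diff_comp (fd x) (ld (f x))) /=.
by rewrite diff_lin.
Qed.

Lemma ndiff_id V n : ndiff n (fun x : V => x).
Proof.
case: n => [|n]; first exact: I.
split=> [x|v]; first exact: (@ex_diff _ _ _ _ _ _ _ (is_diff_id x)).
rewrite (_ : (fun _ => _) = fun=> v); first exact: ndiff_cst.
apply/funext => x.
exact: (congr1 (fun h => h v) (@diff_val _ _ _ _ _ _ _ (is_diff_id x))).
Qed.

(** Differentiability and the value of one directional derivative travel together, so that the
    derivative of a polynomial in coordinates can be assembled by applying the rules below. *)
Definition has_diff V W (x v : V) (f : V -> W) (f' : W) :=
  differentiable f x /\ 'd f x v = f'.

Lemma has_diffD V W (x v : V) (f g : V -> W) f' g' :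
  has_diff x v f f' -> has_diff x v g g' ->
  has_diff x v (fun y => f y + g y) (f' + g').
Proof.
move=> [fd <-] [gd <-]; split; first exact: differentiableD.
by rewrite (diffD fd gd).
Qed.

Lemma has_diffN V W (x v : V) (f : V -> W) f' :
  has_diff x v f f' -> has_diff x v (fun y => - f y) (- f').
Proof.
move=> [fd <-]; split; first exact: differentiableN.
by rewrite (diffN fd).
Qed.

Lemma has_diff_cst V W (x v : V) (c : W) : has_diff x v (fun=> c) 0.
Proof. by split; [exact: differentiable_cst | rewrite diff_cst]. Qed.

Lemma has_diffM V (x v : V) (f g : V -> R) f' g' :
  has_diff x v f f' -> has_diff x v g g' ->
  has_diff x v (fun y => f y * g y) (f' * g x + f x * g').
Proof.
move=> [fd <-] [gd <-]; split; first exact: differentiableM.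
rewrite (diffM fd gd) addrC; congr (_ + _).
exact: mulrC.
Qed.

(** Separates the two tasks: the rules first fill in [f'] by unification, and [ring] then compares
    it with the expected value. *)
Lemma has_diff_eq V (x v : V) (f : V -> R) f' f'' :
  has_diff x v f f' -> f' = f'' -> has_diff x v f f''.
Proof. by move=> h <-. Qed.

Lemma has_diffB V (x v : V) (f h : V -> R) f' h' :
  has_diff x v f f' -> has_diff x v h h' ->
  has_diff x v (fun y => f y - h y) (f' - h').
Proof. by move=> F K; apply: has_diffD => //; exact: has_diffN. Qed.

End Smooth.

(** * Quaternions and the frame *)

Section Quaternions.
Context {R : realType}.

(* The quaternion a + b i + c j + d k, as [realify] of the complex matrix
   [[a + bi, c + di], [- c + di, a - bi]]. *)
Definition qmx (a b c d : R) : 'M[R]_4 :=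
  \matrix_(i, j) nth 0 (nth [::] [:: [:: a; c; - b; - d]; [:: - c; a; - d; b];
                                     [:: b; d; a; c]; [:: d; - b; - c; a]] i) j.

Lemma eq_qmx a b c d a' b' c' d' : a = a' -> b = b' -> c = c' -> d = d' ->
  qmx a b c d = qmx a' b' c' d'.
Proof. by move=> -> -> -> ->. Qed.

Lemma qmx_inj a b c d a' b' c' d' :
  qmx a b c d = qmx a' b' c' d' -> [/\ a = a', b = b', c = c' & d = d'].
Proof.
move=> e; have E i j : qmx a b c d i j = qmx a' b' c' d' i j by rewrite e.
move: (E 0 0) (E 0 (inord 1)) (E (inord 2) 0) (E (inord 3) 0).
by rewrite !mxE !inordK.
Qed.

Lemma qmxD a b c d a' b' c' d' :
  qmx a b c d + qmx a' b' c' d' = qmx (a + a') (b + b') (c + c') (d + d').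
Proof.
by apply/matrixP => -[[|[|[|[|?]]]] //= ?] [[|[|[|[|?]]]] //= ?];
  rewrite !mxE /=; ring.
Qed.

Lemma qmxZ k a b c d : k *: qmx a b c d = qmx (k * a) (k * b) (k * c) (k * d).
Proof.
by apply/matrixP => -[[|[|[|[|?]]]] //= ?] [[|[|[|[|?]]]] //= ?];
  rewrite !mxE /=; ring.
Qed.

Lemma qmxN a b c d : - qmx a b c d = qmx (- a) (- b) (- c) (- d).
Proof.
by apply/matrixP => -[[|[|[|[|?]]]] //= ?] [[|[|[|[|?]]]] //= ?];
  rewrite !mxE.
Qed.

Lemma qmxM a b c d a' b' c' d' :
  qmx a b c d * qmx a' b' c' d' =
  qmx (a * a' - b * b' - c * c' - d * d') (a * b' + b * a' + c * d' - d * c')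
      (a * c' - b * d' + c * a' + d * b') (a * d' + b * c' - c * b' + d * a').
Proof.
apply/matrixP => i j; rewrite !mxE !big_ord_recl big_ord0 !mxE.
by case: i => [[|[|[|[|?]]]] //= ?]; case: j => [[|[|[|[|?]]]] //= ?]; ring.
Qed.

Lemma qmx_tr a b c d : (qmx a b c d)^T = qmx a (- b) (- c) (- d).
Proof.
by apply/matrixP => -[[|[|[|[|?]]]] //= ?] [[|[|[|[|?]]]] //= ?];
  rewrite !mxE /= ?opprK.
Qed.

Lemma qmx1 : qmx 1 0 0 0 = 1.
Proof.
by apply/matrixP => -[[|[|[|[|?]]]] //= ?] [[|[|[|[|?]]]] //= ?];
  rewrite !mxE /= ?oppr0.
Qed.

Lemma qmx0 : qmx 0 0 0 0 = 0.
Proof.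
by apply/matrixP => -[[|[|[|[|?]]]] //= ?] [[|[|[|[|?]]]] //= ?];
  rewrite !mxE /= ?oppr0.
Qed.

Lemma realify_mx2 (z w : R[i]) :
  realify (mx2 z w (- w^*%C) z^*%C) =
  qmx (complex.Re z) (complex.Im z) (complex.Re w) (complex.Im w).
Proof.
case: z w => a b [c d].
apply/matrixP => i j; rewrite /realify /block_mx !mxE.
case: splitP => i' Ei; rewrite !mxE; case: splitP => j' Ej; rewrite !mxE.
all: case: i i' Ei => [[|[|[|[|?]]]] //= ?] [[|[|?]] //= ?] //= _.
all: case: j j' Ej => [[|[|[|[|?]]]] //= ?] [[|[|?]] //= ?] //= _.
all: by rewrite ?opprK.
Qed.

End Quaternions.

Section Frame.
Context {R : realType}.
Implicit Types (p q : nat).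

(** Pairs of purely imaginary quaternions: this is su(2) + su(2) inside the ambient algebra. *)
Definition imag (b c d b' c' d' : R) : amb R := (qmx 0 b c d, qmx 0 b' c' d').

Lemma imagD b1 c1 d1 b1' c1' d1' b2 c2 d2 b2' c2' d2' :
  imag b1 c1 d1 b1' c1' d1' + imag b2 c2 d2 b2' c2' d2' =
  imag (b1 + b2) (c1 + c2) (d1 + d2) (b1' + b2') (c1' + c2') (d1' + d2').
Proof. by congr pair; rewrite /= qmxD addr0. Qed.

Lemma imagZ k b c d b' c' d' :
  k *: imag b c d b' c' d' =
  imag (k * b) (k * c) (k * d) (k * b') (k * c') (k * d').
Proof. by congr pair; rewrite /= qmxZ mulr0. Qed.

Lemma imag0 : imag 0 0 0 0 0 0 = 0.
Proof. by congr pair; rewrite qmx0. Qed.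

(** The norm of the quaternions that represent [sE] and [sV]. In brackets of such elements only its
    square 1/8 survives, so the square root never has to be computed with. *)
Definition nEV : R := (2 * Num.sqrt 2)^-1.

Lemma nEV_sqr : nEV ^+ 2 = 8^-1.
Proof.
by rewrite /nEV exprVn exprMn sqr_sqrtr ?ler0n //; congr (_^-1); ring.
Qed.

Lemma nEV_neq0 : nEV != 0.
Proof. by rewrite -sqrf_eq0 nEV_sqr invr_eq0 pnatr_eq0. Qed.

Lemma imC (z : R) : 'i%R * z%:C%C = Complex 0 z.
Proof.
rewrite -[LHS]/(Complex (0 * z - 1 * 0) (0 * 0 + 1 * z)).
by rewrite !mul0r mulr0 mul1r subr0 add0r.
Qed.

Lemma scaleC (k a b : R) : k%:C%C * Complex a b = Complex (k * a) (k * b).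
Proof.
rewrite -[LHS]/(Complex (k * a - 0 * b) (k * b + 0 * a)).
by rewrite !mul0r subr0 addr0.
Qed.

Lemma eq_mx2 (a b c d a' b' c' d' : R[i]) :
  a = a' -> b = b' -> c = c' -> d = d' ->
  mx2 a b c d = mx2 a' b' c' d'.
Proof. by move=> -> -> -> ->. Qed.

Lemma mx2Z (k a b c d : R[i]) :
  k *: mx2 a b c d = mx2 (k * a) (k * b) (k * c) (k * d).
Proof.
by apply/matrixP => i j; rewrite !mxE; case: ifP; case: ifP.
Qed.

Lemma realify0 : realify 0 = 0 :> 'M[R]_4.
Proof.
by rewrite -qmx0; apply/matrixP => i j; rewrite /realify /block_mx !mxE;
  case: splitP => i' Ei; rewrite !mxE; case: splitP => j' Ej; rewrite !mxE ?oppr0;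
  move: Ei Ej; case: i => [[|[|[|[|?]]]] //= ?] _;
  case: j => [[|[|[|[|?]]]] //= ?] _; rewrite ?oppr0.
Qed.

Lemma half_i : 'i%R / 2 = Complex 0 2^-1 :> R[i].
Proof. by rewrite -imC fmorphV rmorph_nat. Qed.

Lemma realify_sH (k : R) : realify (k%:C%C *: sH) = qmx 0 (k / 2) 0 0.
Proof.
rewrite /sH mx2Z -(realify_mx2 (Complex 0 (k / 2)) 0).
congr realify; apply: eq_mx2; rewrite ?mulr0 ?rmorph0 ?oppr0 //.
  by rewrite half_i scaleC mulr0.
by rewrite half_i mulrN scaleC mulr0 -[LHS]/(Complex (- 0) (- (k / 2))) oppr0.
Qed.

Lemma realify_sE : realify sE = qmx 0 0 nEV 0.
Proof.
rewrite -(realify_mx2 0 (Complex nEV 0)); congr realify.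
apply: eq_mx2; rewrite ?rmorph0 //.
by rewrite -[RHS]/(Complex (- nEV) (- - 0)) !oppr0.
Qed.

Lemma realify_sV : realify sV = qmx 0 0 0 nEV.
Proof.
have e : ('i%R / (2 * Num.sqrt 2 : R)%:C%C) = Complex 0 nEV.
  by rewrite -fmorphV imC.
rewrite -(realify_mx2 0 (Complex 0 nEV)); congr realify.
apply: eq_mx2; rewrite ?rmorph0 //.
rewrite e -[RHS]/(Complex (- 0) (- - nEV)) oppr0 opprK //.
Qed.

Lemma frame_imag p q :
  frame p q =
  [tuple imag (p%:R / 2) 0 0 (q%:R / 2) 0 0;
         imag (q%:R / 2) 0 0 (- p%:R / 2) 0 0;
         imag 0 nEV 0 0 0 0; imag 0 0 nEV 0 0 0;
         imag 0 0 0 0 nEV 0; imag 0 0 0 0 0 nEV] :> 6.-tuple (amb R).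
Proof.
have e (n : nat) : n%:R = (n%:R : R)%:C%C :> R[i] by rewrite rmorph_nat.
have e' (n : nat) : - n%:R = (- n%:R : R)%:C%C :> R[i].
  by rewrite rmorphN rmorph_nat.
apply: val_inj; rewrite /= /emb /imag e' !e !realify_sH realify_sE realify_sV.
by rewrite realify0 qmx0.
Qed.
End Frame.

(** * Coordinates and brackets on m *)

Section Coframe.
Context {R : realType} (p q : nat).
Hypothesis q_gt0 : (0 < q)%N.
Local Notation P := (p%:R : R).
Local Notation Q := (q%:R : R).
Local Notation c := (@coframe R p q).

Lemma sumsq_neq0 : P ^+ 2 + Q ^+ 2 != 0.
Proof.
by rewrite gt_eqF // ltr_wpDl ?sqr_ge0 // exprn_gt0 // ltr0n.
Qed.

Lemma frame_sum (k : nat -> R) :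
  \sum_(j < 6) k j *: (frame p q)`_j =
  imag ((P * k 0 + Q * k 1) / 2) (nEV * k 2) (nEV * k 3)
       ((Q * k 0 - P * k 1) / 2) (nEV * k 4) (nEV * k 5) :> amb R.
Proof.
rewrite frame_imag !big_ord_recl big_ord0 /= !imagZ addr0 !imagD.
by congr pair; apply: eq_qmx; ring.
Qed.

Lemma imag_inj b c d b' c' d' x y z x' y' z' :
  imag b c d b' c' d' = imag x y z x' y' z' :> amb R ->
  [/\ b = x, c = y & d = z] /\ [/\ b' = x', c' = y' & d' = z'].
Proof. by case=> /qmx_inj[_ -> -> ->] /qmx_inj[_ -> -> ->]. Qed.

(** The coefficients 0 and 1 meet only in the two i-components, through the matrix with rows (P, Q)
    and (Q, -P), whose determinant is -(P^2 + Q^2). Each other coefficient is alone in its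
    component, up to the factor [nEV]. *)
Lemma frame_free : free (frame p q : seq (amb R)).
Proof.
apply/freeP => k.
pose k' n := k (inord n).
have -> : \sum_(i < 6) k i *: (frame p q)`_i =
          \sum_(i < 6) k' i *: (frame p q)`_i :> amb R.
  by apply: eq_bigr => i _; rewrite /k' inord_val.
rewrite frame_sum -imag0 => /imag_inj[[h0 h2 h3] [h1 h4 h5]].
have cancel x : nEV * x = 0 -> x = 0 :> R.
  by move/eqP; rewrite mulf_eq0 (negPf nEV_neq0) => /eqP.
have e0 : P * k' 0 + Q * k' 1 = 0 by move: h0; lra.
have e1 : Q * k' 0 - P * k' 1 = 0 by move: h1; lra.
have z0 : k' 0 = 0.
  apply: (mulfI sumsq_neq0).
  transitivity (P * (P * k' 0 + Q * k' 1) + Q * (Q * k' 0 - P * k' 1)).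
    by ring.
  by rewrite e0 e1; ring.
have z1 : k' 1 = 0.
  apply: (mulfI sumsq_neq0).
  transitivity (Q * (P * k' 0 + Q * k' 1) - P * (Q * k' 0 - P * k' 1)).
    by ring.
  by rewrite e0 e1; ring.
move=> i; rewrite -(inord_val i) -/(k' i).
by case: i => [[|[|[|[|[|[|?]]]]]] //= ?]; auto.
Qed.

Lemma coframe_is_linear i : linear (c i).
Proof. by move=> k u v; rewrite /coframe linearP. Qed.

HB.instance Definition _ i :=
  GRing.isLinear.Build R (amb R) R _ (c i) (coframe_is_linear i).

Lemma coframe_frame_sum (k : nat -> R) i : (i < 6)%N ->
  c i (imag ((P * k 0 + Q * k 1) / 2) (nEV * k 2) (nEV * k 3)
       ((Q * k 0 - P * k 1) / 2) (nEV * k 4) (nEV * k 5)) = k i.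
Proof.
move=> i6; rewrite -frame_sum /coframe.
rewrite (coord_sum_free (fun j : 'I_6 => k j) (inord i) frame_free).
by rewrite inordK.
Qed.

Lemma coframe_imag x y z x' y' z' :
  let v := imag x y z x' y' z' in
  [/\ c 1 v = 2 * (Q * x - P * x') / (P ^+ 2 + Q ^+ 2),
      c 2 v = y / nEV, c 3 v = z / nEV, c 4 v = y' / nEV & c 5 v = z' / nEV].
Proof.
have Nn := sumsq_neq0; have sn := @nEV_neq0 R.
(* The six frame coordinates of [v], found by inverting the linear system displayed in
   [frame_sum]. *)
pose k := nth 0 [:: 2 * (P * x + Q * x') / (P ^+ 2 + Q ^+ 2);
  2 * (Q * x - P * x') / (P ^+ 2 + Q ^+ 2);
  y / nEV; z / nEV; y' / nEV; z' / nEV].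
have e : imag x y z x' y' z' =
  imag ((P * k 0 + Q * k 1) / 2) (nEV * k 2) (nEV * k 3)
       ((Q * k 0 - P * k 1) / 2) (nEV * k 4) (nEV * k 5).
  rewrite /k /=; congr pair; apply: eq_qmx => //; field; rewrite ?Nn ?sn //.
by rewrite /= e; split; rewrite coframe_frame_sum.
Qed.

(* Elements of m are handled through coordinate functions [u : nat -> R], of
   which only the values at 1, ..., 5 matter. *)
Definition mvec (u : nat -> R) : amb R :=
  imag (Q * u 1 / 2) (nEV * u 2) (nEV * u 3)
       (- (P * u 1 / 2)) (nEV * u 4) (nEV * u 5).

Lemma mvec_sum u : mvec u = \sum_(1 <= i < 6) u i *: (frame p q)`_i.
Proof.
rewrite /mvec frame_imag big_add1 big_mkord !big_ord_recl big_ord0 /= !imagZ.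
rewrite addr0 !imagD.
by congr pair; apply: eq_qmx; ring.
Qed.

Lemma coframe_mvec u i : (0 < i < 6)%N -> c i (mvec u) = u i.
Proof.
(* The coordinate along the Lie algebra of K is set to 0, whatever [u 0] is. *)
move=> /andP[i0 i6]; pose k n := if n == 0%N then 0 else u n.
have -> : mvec u = imag ((P * k 0 + Q * k 1) / 2) (nEV * k 2) (nEV * k 3)
       ((Q * k 0 - P * k 1) / 2) (nEV * k 4) (nEV * k 5).
  by rewrite /k /=; congr pair; apply: eq_qmx => //; ring.
by rewrite coframe_frame_sum // /k; case: i i0 i6.
Qed.

Lemma pr_mE v : pr_m p q v = mvec (fun i => c i v).
Proof. by rewrite mvec_sum. Qed.

Lemma coframe_pr_m v i : (0 < i < 6)%N -> c i (pr_m p q v) = c i v.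
Proof. by move=> h; rewrite pr_mE coframe_mvec. Qed.

Lemma mvec_in u : mvec u \in m_space p q.
Proof.
rewrite mvec_sum big_nat; apply: rpred_sum => i /andP[i0 i6].
apply/rpredZ/memv_span; case: i i0 i6 => // i _ i6.
rewrite -[_`_i.+1](nth_behead (0 : amb R) (frame p q) i).
by apply: mem_nth; rewrite size_behead size_tuple.
Qed.

Lemma m_spaceE v : v \in m_space p q -> v = mvec (fun i => c i v).
Proof.
move=> /(@coord_span _ _ _ (behead_tuple (frame p q))).
(* The basis of m is the frame without its head, so coordinate [n] of the frame is coordinate
   [n - 1] here. *)
pose k n := coord (behead_tuple (frame p q)) (inord n.-1) v.
have -> : \sum_(i < 6.-1) coord (behead_tuple (frame p q)) i v *:
    (behead_tuple (frame p q))`_i = mvec k.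
  rewrite mvec_sum big_add1 big_mkord; apply: eq_bigr => i _.
  by rewrite /k /= inord_val.
move=> vE; rewrite [in LHS]vE; have ck i : (0 < i < 6)%N -> c i v = k i.
  by move=> h; rewrite vE coframe_mvec.
by rewrite /mvec !ck.
Qed.

(* The i-th coordinate of [u, v]. *)
Definition bracket_m (i : nat) (u v : nat -> R) : R :=
  match i with
  | 1 => (Q * (u 2 * v 3 - u 3 * v 2) - P * (u 4 * v 5 - u 5 * v 4))
           / (2 * (P ^+ 2 + Q ^+ 2))
  | 2 => - (Q * (u 1 * v 3 - u 3 * v 1))
  | 3 => Q * (u 1 * v 2 - u 2 * v 1)
  | 4 => P * (u 1 * v 5 - u 5 * v 1)
  | 5 => - (P * (u 1 * v 4 - u 4 * v 1))
  | _ => 0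
  end.

(** The products [u * v] and [v * u] have the same real parts, so their difference is imaginary and
    its coordinates are given by [coframe_imag]. The additive form makes the lemma a rewriting rule
    that orders products. *)
Lemma coframe_bracket u v i : u \in m_space p q -> v \in m_space p q ->
  (0 < i < 6)%N ->
  c i (u * v) = c i (v * u) + bracket_m i (c ^~ u) (c ^~ v).
Proof.
move=> /m_spaceE eu /m_spaceE ev hi; apply/eqP.
rewrite addrC -subr_eq -raddfB /= [in X in _ == X]/bracket_m.
set a := c ^~ u in eu *; set b := c ^~ v in ev *.
pose x := nEV ^+ 2 * 2 * (a 2 * b 3 - a 3 * b 2).
pose x' := nEV ^+ 2 * 2 * (a 4 * b 5 - a 5 * b 4).
pose k := nth 0 [:: 0; 0;
   - (Q * (a 1 * b 3 - a 3 * b 1));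
   Q * (a 1 * b 2 - a 2 * b 1);
   P * (a 1 * b 5 - a 5 * b 1);
   - (P * (a 1 * b 4 - a 4 * b 1))].
have -> : u * v - v * u =
    imag x (nEV * k 2) (nEV * k 3) x' (nEV * k 4) (nEV * k 5).
  rewrite eu ev /mvec /imag /k /x /x'.
  by congr pair; rewrite /= !qmxM qmxN qmxD; apply: eq_qmx; field.
have [h1 h2 h3 h4 h5] :=
  coframe_imag x (nEV * k 2) (nEV * k 3) x' (nEV * k 4) (nEV * k 5).
have sn := @nEV_neq0 R; have Nn := sumsq_neq0.
case: i hi => [|[|[|[|[|[|?]]]]]] //= _; apply/eqP.
- by rewrite h1 /x /x' nEV_sqr; field.
- by rewrite h2 /k /=; field.
- by rewrite h3 /k /=; field.
- by rewrite h4 /k /=; field.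
- by rewrite h5 /k /=; field.
Qed.

End Coframe.

(** * The groups G and K in quaternions *)

Section Group.
Context {R : realType} (p q : nat).
Hypothesis q_gt0 : (0 < q)%N.
Local Notation c := (@coframe R p q).

Lemma ord2P (i : 'I_2) : i = 0 \/ i = 1.
Proof. by case: i => [[|[|?]]] // h; [left|right]; exact: val_inj. Qed.

Lemma det_2 (S : comNzRingType) (a : 'M[S]_2) :
  \det a = a 0 0 * a 1 1 - a 0 1 * a 1 0.
Proof.
rewrite (expand_det_row _ 0) !big_ord_recl big_ord0 addr0 /cofactor !det_mx11.
rewrite !mxE /=.
have e1 : lift 0 0 = 1 :> 'I_2 by exact/val_inj.
have e0 : lift 1 0 = 0 :> 'I_2 by exact/val_inj.
by rewrite !e1 !e0 /= addn0 expr0 add0n expr1; ring.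
Qed.

(** The inverse of such a matrix is both its adjoint and its adjugate, so the first row determines
    the second. The explicit combinations for [D] and [C] derive this from the determinant and the
    orthonormality of the rows. *)
Lemma SU2_quaternion (a : 'M[R[i]]_2) : SU2 a -> exists x y z w : R,
  realify a = qmx x y z w /\ x ^+ 2 + y ^+ 2 + z ^+ 2 + w ^+ 2 = 1.
Proof.
case=> /unitarymxP aU da.
have E i j := congr1 (fun M : 'M[R[i]]_2 => M i j) aU.
have e00 := E 0 0; have e10 := E 1 0; have e01 := E 0 1; have e11 := E 1 1.
move: da e00 e10 e01 e11 => /=.
rewrite det_2 !mxE !big_ord_recl !big_ord0 !mxE /= !addr0.
have l1 : lift ord0 ord0 = 1 :> 'I_2 by exact: val_inj.
rewrite !l1 -[ord0]/(0 : 'I_2).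
set A := a 0 0; set B := a 0 1; set C := a 1 0; set D := a 1 1.
move=> dE e00 e10 e01 e11.
have DE : D = A^*%C.
  transitivity (A^*%C * (A * D - B * C) + B * (C * A^*%C + D * B^*%C)
    + D * (1 - (A * A^*%C + B * B^*%C))); first by ring.
  by rewrite dE e10 e00; ring.
have CE : C = - B^*%C.
  transitivity (- B^*%C * (A * D - B * C) + A * (C * A^*%C + D * B^*%C)
    + C * (1 - (A * A^*%C + B * B^*%C))); first by ring.
  by rewrite dE e10 e00; ring.
have -> : a = mx2 A B (- B^*%C) A^*%C.
  apply/matrixP => i j; rewrite -DE -CE mxE.
  by case: (ord2P i) => ->; case: (ord2P j) => ->; reflexivity.
rewrite realify_mx2; do 4!eexists; split; first by [].
move: e00; case: A {DE dE e10 e01 e11} => x y; case: B {CE} => z w.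
move/(congr1 (@complex.Re R)) => /=.
by rewrite !expr2 => <-; ring.
Qed.

Lemma G_quaternion (x : amb R) : G x -> exists a b d e a' b' d' e' : R,
  [/\ x = (qmx a b d e, qmx a' b' d' e'),
      a ^+ 2 + b ^+ 2 + d ^+ 2 + e ^+ 2 = 1 &
      a' ^+ 2 + b' ^+ 2 + d' ^+ 2 + e' ^+ 2 = 1].
Proof.
case=> [m [n [/SU2_quaternion[a [b [d [e [em na]]]]]]]].
move=> /SU2_quaternion[a' [b' [d' [e' [en na']]]]] ->.
by exists a, b, d, e, a', b', d', e'; rewrite /emb em en.
Qed.

Lemma K_quaternion k : K p q k -> exists a b a' b' : R,
  [/\ k = (qmx a b 0 0, qmx a' b' 0 0), a ^+ 2 + b ^+ 2 = 1 &
      a' ^+ 2 + b' ^+ 2 = 1].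
Proof.
case=> z [nz ->].
have H n : exists a b : R, realify (mx2 (z ^+ n) 0 0 (z ^- n)) = qmx a b 0 0 /\
    a ^+ 2 + b ^+ 2 = 1.
  have zn : `|z ^+ n| ^+ 2 = 1 by rewrite normrX nz !expr1n.
  have zi : z ^- n = (z ^+ n)^*%C.
    have zz : z ^+ n * (z ^+ n)^*%C = 1 by rewrite -zn; exact/esym/sqr_normc.
    have z0 : z ^+ n != 0.
      apply/eqP => h; move: zz; rewrite h mul0r => /esym/eqP.
      by rewrite oner_eq0.
    by apply: (mulfI z0); rewrite zz mulfV.
  rewrite zi.
  have -> : mx2 (z ^+ n) 0 0 (z ^+ n)^*%C =
      mx2 (z ^+ n) 0 (- 0^*%C) (z ^+ n)^*%C.
    by apply: eq_mx2 => //; rewrite rmorph0 oppr0.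
  rewrite realify_mx2; do 2!eexists; split; first by [].
  move: zn; case: (z ^+ n) => u w; rewrite normc_def -rmorphXn.
  rewrite sqr_sqrtr ?addr_ge0 ?sqr_ge0 //.
  by move=> /(congr1 (@complex.Re R)).
have [a [b [e na]]] := H p; have [a' [b' [e' na']]] := H q.
rewrite /emb e e'.
by exists a, b, a', b'.
Qed.

Lemma ginvV (x : amb R) : G x -> ginv x * x = 1 /\ x * ginv x = 1.
Proof.
case/G_quaternion => [a [b [d [e [a' [b' [d' [e' [-> n n']]]]]]]]].
by split; congr pair; rewrite /= qmx_tr qmxM -qmx1; apply: eq_qmx;
  first [ring | by rewrite -n; ring | by rewrite -n'; ring].
Qed.

Lemma G1 : G (1 : amb R).
Proof.
have S1 : SU2 (1 : 'M[R[i]]_2).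
  split; last exact: det1.
  by apply/unitarymxP; rewrite (@trmx1 _ 2) map_mx1 mulmx1.
exists 1, 1; split => //.
have -> : (1 : 'M[R[i]]_2) = mx2 1 0 (- 0^*%C) 1^*%C.
  apply/matrixP => i j; rewrite !mxE.
  by case: (ord2P i) => ->; case: (ord2P j) => ->;
    rewrite ?rmorph0 ?rmorph1 ?oppr0.
by rewrite /emb realify_mx2 /= qmx1.
Qed.

Lemma ginvM (x y : amb R) : ginv (x * y) = ginv y * ginv x.
Proof. by congr pair; exact: trmx_mul. Qed.

Lemma ginv1 : ginv 1 = (1 : amb R).
Proof. by congr pair; exact: trmx1. Qed.

Lemma ginv_imag (x y z x' y' z' : R) :
  ginv (imag x y z x' y' z') = - imag x y z x' y' z'.
Proof. by congr pair; rewrite /= qmx_tr qmxN oppr0. Qed.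

(** The adjoint action of G preserves su(2) + su(2); the resulting coefficients are left to
    unification, as only their existence matters. *)
Lemma conj_imag (x : amb R) b1 b2 b3 b1' b2' b3' : G x ->
  exists d1 d2 d3 d1' d2' d3',
  ginv x * imag b1 b2 b3 b1' b2' b3' * x = imag d1 d2 d3 d1' d2' d3' :> amb R.
Proof.
case/G_quaternion => [a [b [d [e [a' [b' [d' [e' [-> _ _]]]]]]]]].
do 6!eexists; rewrite /imag /ginv /=.
congr pair; rewrite /= qmx_tr !qmxM;
  (apply: eq_qmx; [ring | reflexivity..]).
Qed.

(** The adjoint action of K fixes the i-component of each factor and rotates its plane of j- and
    k-components, so it commutes with the projection onto m. This is the source of K-equivariance
    for the fields [killing]. *)
Lemma pr_m_K (k : amb R) b1 b2 b3 b1' b2' b3' (v := imag b1 b2 b3 b1' b2' b3') :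
  K p q k -> k * pr_m p q (ginv k * v * k) = pr_m p q v * k.
Proof.
case/K_quaternion => [a [b [a' [b' [ek n n']]]]].
(* Multiplying one side by the squared norm of a factor of [k], which is 1, gives both sides the
   same degree in [k]; [ring] can then compare them. *)
have mn (x : R) : x = (a ^+ 2 + b ^+ 2) * x by rewrite n mul1r.
have mn' (x : R) : x = (a' ^+ 2 + b' ^+ 2) * x by rewrite n' mul1r.
pose c2 := (a ^+ 2 - b ^+ 2) * b2 + 2 * a * b * b3.
pose c3 := (a ^+ 2 - b ^+ 2) * b3 - 2 * a * b * b2.
pose c2' := (a' ^+ 2 - b' ^+ 2) * b2' + 2 * a' * b' * b3'.
pose c3' := (a' ^+ 2 - b' ^+ 2) * b3' - 2 * a' * b' * b2'.
have e : ginv k * v * k = imag b1 c2 c3 b1' c2' c3'.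
  rewrite ek /v /imag; congr pair; rewrite /= qmx_tr !qmxM /c2 /c3 /c2' /c3';
    apply: eq_qmx; try ring.
    by rewrite [RHS]mn; ring.
  by rewrite [RHS]mn'; ring.
rewrite e !pr_mE //.
have [h1 h2 h3 h4 h5] := coframe_imag p q_gt0 b1 b2 b3 b1' b2' b3'.
have [g1 g2 g3 g4 g5] := coframe_imag p q_gt0 b1 c2 c3 b1' c2' c3'.
have sn := @nEV_neq0 R; have nN := @sumsq_neq0 R p q q_gt0.
rewrite /mvec g1 g2 g3 g4 g5 h1 h2 h3 h4 h5 ek.
have cn (x : R) : nEV * (x / nEV) = x by rewrite mulrC divfK.
rewrite !cn.
congr pair; rewrite /= !qmxM /c2 /c3 /c2' /c3'; apply: eq_qmx; try ring.
- by rewrite [RHS]mn; ring.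
- by rewrite [RHS]mn; ring.
- by rewrite [RHS]mn'; ring.
- by rewrite [RHS]mn'; ring.
Qed.

End Group.

(** * The invariant tensors in coordinates *)

Section Algebra.
Context {R : realType} (p q : nat).
Hypotheses (p_gt0 : (0 < p)%N) (q_gt0 : (0 < q)%N).
Local Notation P := (p%:R : R).
Local Notation Q := (q%:R : R).
Local Notation N := (P ^+ 2 + Q ^+ 2).
Implicit Types u v w : nat -> R.
Local Notation brk := (@bracket_m R p q).

Definition gC u v : R :=
  2 * N * (u 1 * v 1) + Q ^+ 2 / N * (u 2 * v 2 + u 3 * v 3)
  + P ^+ 2 / N * (u 4 * v 4 + u 5 * v 5).

Definition hC u v w : R :=
  Q * (u 1 * (v 2 * w 3 - v 3 * w 2) - u 2 * (v 1 * w 3 - v 3 * w 1)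
       + u 3 * (v 1 * w 2 - v 2 * w 1))
  + P * (u 1 * (v 4 * w 5 - v 5 * w 4) - u 4 * (v 1 * w 5 - v 5 * w 1)
       + u 5 * (v 1 * w 4 - v 4 * w 1)).

Lemma gC_ext u u' v v' : (forall i, (0 < i < 6)%N -> u i = u' i) ->
  (forall i, (0 < i < 6)%N -> v i = v' i) -> gC u v = gC u' v'.
Proof. by move=> e f; rewrite /gC !e // !f. Qed.

(* The symmetric part U of the Levi-Civita connection on m, where
   2 g(U(u, v), w) = - g(v, [u, w]_m) - g(u, [v, w]_m). *)
Definition symC i u v : R :=
  let a := (Q - N / Q) / 2 in let b := (P - N / P) / 2 in
  match i with
  | 2 => - (a * (u 1 * v 3 + u 3 * v 1))
  | 3 => a * (u 1 * v 2 + u 2 * v 1)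
  | 4 => b * (u 1 * v 5 + u 5 * v 1)
  | 5 => - (b * (u 1 * v 4 + u 4 * v 1))
  | _ => 0
  end.

Definition nablaC i u v : R := brk i u v / 2 + symC i u v.

(** The vector dual under [gC] to H(u, v, .) / 2: the difference between the Bismut and the
    Levi-Civita connections. *)
Definition sharpC i u v : R :=
  match i with
  | 1 => (Q * (u 2 * v 3 - u 3 * v 2) + P * (u 4 * v 5 - u 5 * v 4)) / (4 * N)
  | 2 => - (N / Q * (u 1 * v 3 - u 3 * v 1) / 2)
  | 3 => N / Q * (u 1 * v 2 - u 2 * v 1) / 2
  | 4 => - (N / P * (u 1 * v 5 - u 5 * v 1) / 2)
  | 5 => N / P * (u 1 * v 4 - u 4 * v 1) / 2
  | _ => 0
  end.

Lemma Pn0 : P != 0. Proof. by rewrite pnatr_eq0 -lt0n. Qed.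
Lemma Qn0 : Q != 0. Proof. by rewrite pnatr_eq0 -lt0n. Qed.
Lemma Nn0 : N != 0. Proof. exact: sumsq_neq0. Qed.

Lemma gC_sharp u v w : gC (fun i => sharpC i u v) w = hC u v w / 2.
Proof.
by rewrite /gC /hC /sharpC /=; field; rewrite Nn0 Pn0 Qn0.
Qed.

Lemma gC_sym u v w : gC (fun i => symC i u v) w =
  - (gC v (fun i => brk i u w) + gC u (fun i => brk i v w)) / 2.
Proof.
by rewrite /gC /symC /bracket_m /=; field; rewrite Nn0 Pn0 Qn0.
Qed.

(** The left side is the differential of the invariant form. By the brackets, de^1 is a multiple of
    q e^23 - p e^45, while e^23 and e^45 contribute nothing; the wedge of de^1 with q e^23 + p e^45
    vanishes because the two mixed terms cancel. *)
Lemma hC_closed u v w z :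
  - hC (fun i => brk i u v) w z + hC (fun i => brk i u w) v z
  - hC (fun i => brk i u z) v w - hC (fun i => brk i v w) u z
  + hC (fun i => brk i v z) u w - hC (fun i => brk i w z) u v = 0.
Proof.
by rewrite /hC /bracket_m /=; field; rewrite Nn0.
Qed.

(** Here [d], [b] and [l] stand for [dcoord], [pcoord] and the coordinates of Lie brackets. The [d]
    terms cancel against [l], the [b] terms pair up into brackets, and [hC_closed] disposes of what
    remains. *)
Lemma closed_alg (t : R) (x : nat -> nat -> R)
    (d b l : nat -> nat -> nat -> R) :
  (forall m n i, (0 < i < 6)%N -> l m n i = d m n i - d n m i) ->
  (forall m n i, (0 < i < 6)%N -> b m n i = b n m i + brk i (x m) (x n)) ->
  let D m n i := d m n i - b m n i in
  let x0 := x 0 in let x1 := x 1 in let x2 := x 2 in let x3 := x 3 in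
  t * (hC (D 0 1) x2 x3 + hC x1 (D 0 2) x3 + hC x1 x2 (D 0 3))
  - t * (hC (D 1 0) x2 x3 + hC x0 (D 1 2) x3 + hC x0 x2 (D 1 3))
  + t * (hC (D 2 0) x1 x3 + hC x0 (D 2 1) x3 + hC x0 x1 (D 2 3))
  - t * (hC (D 3 0) x1 x2 + hC x0 (D 3 1) x2 + hC x0 x1 (D 3 2))
  - t * hC (l 0 1) x2 x3 + t * hC (l 0 2) x1 x3 - t * hC (l 0 3) x1 x2
  - t * hC (l 1 2) x0 x3 + t * hC (l 1 3) x0 x2 - t * hC (l 2 3) x0 x1 = 0.
Proof.
move=> lE bE /=.
have e := congr1 ( *%R t) (hC_closed (x 0) (x 1) (x 2) (x 3)).
rewrite mulr0 in e; rewrite -[RHS]e /hC; cbv beta.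
rewrite !lE // !(bE 0) // !(bE 1 2) // !(bE 1 3) // !(bE 2 3) //; ring.
Qed.

(** For the Levi-Civita connection and t = 1, this is minus the covariant derivative of H along [u],
    evaluated at [x], [v], [w]. *)
Definition covC (u x v w : nat -> R) : R :=
  hC (fun i => nablaC i u x) v w + hC x (fun i => nablaC i u v) w
  + hC x v (fun i => nablaC i u w).

(** Koszul's argument with [c] for the coordinates of the connection: the first hypothesis is
    vanishing torsion, the last one compatibility with the metric. *)
Lemma koszul_alg (x : nat -> nat -> R) (c d b : nat -> nat -> nat -> R) :
  (forall m n i, (0 < i < 6)%N -> c m n i - c n m i = d m n i - d n m i) ->
  (forall m n i, (0 < i < 6)%N -> b m n i = b n m i + brk i (x m) (x n)) ->
  let D m n i := d m n i - b m n i in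
  (forall m n k, gC (D m n) (x k) + gC (x n) (D m k) =
                 gC (c m n) (x k) + gC (x n) (c m k)) ->
  gC (c 0 1) (x 2) =
  gC (fun i => d 0 1 i - (b 0 1 i + b 1 0 i) / 2 + symC i (x 0) (x 1)) (x 2).
Proof.
move=> cE bE D M.
have cE' m n i : (0 < i < 6)%N -> c m n i = c n m i + (d m n i - d n m i).
  by move=> hi; rewrite -cE // addrC subrK.
have -> : gC (fun i => d 0 1 i - (b 0 1 i + b 1 0 i) / 2
                       + symC i (x 0) (x 1)) (x 2) =
    gC (fun i => d 0 1 i - (b 0 1 i + b 1 0 i) / 2) (x 2)
   + gC (fun i => symC i (x 0) (x 1)) (x 2) by rewrite /gC; ring.
rewrite gC_sym.
have e0 := M 0 1 2; have e1 := M 1 0 2; have e2 := M 2 0 1.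
apply/eqP; rewrite -subr_eq0; apply/eqP.
have h (a b' : R) : a = b' -> b' - a = 0 by move=> ->; rewrite subrr.
move/h: e0 => e0; move/h: e1 => e1; move/h: e2 => e2.
pose M' m n k := gC (c m n) (x k) + gC (x n) (c m k)
  - (gC (D m n) (x k) + gC (x n) (D m k)).
(* The usual cyclic combination of three metric identities; torsion and brackets then reduce all
   terms to the order of indices in the goal. *)
transitivity ((M' 0 1 2 + M' 1 0 2 - M' 2 0 1) / 2);
  last by rewrite /M' e0 e1 e2; ring.
rewrite /M' /gC /D; cbv beta.
rewrite !(bE 0) // !(bE 1 2) // !(cE' 0) // !(cE' 1 2) //.
move: (P ^+ 2 / N) (Q ^+ 2 / N) => k1 k2; by field.
Qed.

(** H has constant coefficients in these coordinates, so the derivatives [D] of the coordinates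
    cancel and only the algebraic part [L] of the connection is left. *)
Lemma cov_alg (t : R) (x : nat -> nat -> R) (D c : nat -> nat -> R)
    (L : nat -> (nat -> R) -> (nat -> R) -> R) :
  (forall n i, (0 < i < 6)%N -> c n i = D n i + L i (x 0) (x n)) ->
  t * (hC (D 1) (x 2) (x 3) + hC (x 1) (D 2) (x 3) + hC (x 1) (x 2) (D 3))
  - t * hC (c 1) (x 2) (x 3) - t * hC (x 1) (c 2) (x 3)
  - t * hC (x 1) (x 2) (c 3) =
  - t * (hC (fun i => L i (x 0) (x 1)) (x 2) (x 3)
       + hC (x 1) (fun i => L i (x 0) (x 2)) (x 3)
       + hC (x 1) (x 2) (fun i => L i (x 0) (x 3))).
Proof. by move=> cE; rewrite /hC !cE //; ring. Qed.

Definition delta (a i : nat) : R := (i == a)%:R.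

Lemma covC_expand u x v w :
  covC u x v w =
  \sum_(1 <= a < 6) \sum_(1 <= b < 6) u a * x b * covC (delta a) (delta b) v w.
Proof.
do 2 rewrite !big_add1 !big_mkord !big_ord_recl !big_ord0 /=.
rewrite /covC /nablaC /symC /hC /bracket_m /delta /=.
by field; rewrite Nn0 Pn0 Qn0.
Qed.

Definition gdiag (a : nat) : R := gC (delta a) (delta a).

Lemma gC_deltal a v : (0 < a < 6)%N -> gC (delta a) v = gdiag a * v a.
Proof.
by case: a => [|[|[|[|[|[|?]]]]]] // _; rewrite /gdiag /gC /delta /=; ring.
Qed.

Lemma gC_comm u v : gC u v = gC v u.
Proof. by rewrite /gC; ring. Qed.

Lemma gdiag_neq0 a : (0 < a < 6)%N -> gdiag a != 0.
Proof.
case: a => [|[|[|[|[|[|?]]]]]] // _; rewrite /gdiag /gC /delta /=;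
  rewrite !(mulr0, mulr1, addr0, add0r);
  by rewrite ?mulf_neq0 ?invr_neq0 ?expf_neq0 ?Nn0 ?Pn0 ?Qn0 ?pnatr_eq0.
Qed.

(** Up to sign and scale this is the codifferential of H, computed in the orthogonal basis e_1, ...,
    e_5; dividing by [gdiag] accounts for vectors that are not of unit length. *)
Lemma covC_trace v w :
  \sum_(1 <= a < 6) covC (delta a) (delta a) v w / gdiag a = 0.
Proof.
rewrite !big_add1 !big_mkord !big_ord_recl !big_ord0 /=.
rewrite /gdiag /gC /covC /nablaC /symC /hC /bracket_m /delta /=.
by field; rewrite Nn0 Pn0 Qn0.
Qed.

Lemma hC_bismut (e : nat -> nat -> R) :
  (forall k i, (0 < i < 6)%N -> e k i = delta k i) ->
  let L i u v := nablaC i u v + sharpC i u v in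
  hC (fun i => L i (e 2) (e 3)) (e 4) (e 5)
  + hC (e 3) (fun i => L i (e 2) (e 4)) (e 5)
  + hC (e 3) (e 4) (fun i => L i (e 2) (e 5)) = P * Q / (2 * N).
Proof.
move=> eE; rewrite /nablaC /symC /sharpC /hC /bracket_m /= !eE // /delta /=.
by field; rewrite Nn0 Pn0 Qn0.
Qed.

End Algebra.

(** * Orthonormal frames and traces *)

Section Orthonormal.
Context {R : realType} (p q : nat).
Hypotheses (p_gt0 : (0 < p)%N) (q_gt0 : (0 < q)%N).
Local Notation gC := (@gC R p q).
Local Notation gdiag := (@gdiag R p q).
Variables (t : R) (c : 'I_5 -> nat -> R).
Hypotheses (t_neq0 : t != 0)
  (c_orth : forall i j, t * gC (c i) (c j) = (i == j)%:R).

Lemma gC_sum u v : gC u v = \sum_(j < 5) gdiag j.+1 * (u j.+1 * v j.+1).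
Proof.
rewrite !big_ord_recl big_ord0 /gdiag /gC /delta /=; ring.
Qed.

(** Orthonormality says that [M *m T] is the identity; for square matrices [T *m M] is then the
    identity too, which is this completeness relation. *)
Lemma orthonormal_dual (a b : 'I_5) :
  \sum_k t * gdiag a.+1 * c k a.+1 * c k b.+1 = (a == b)%:R.
Proof.
pose M : 'M[R]_5 := \matrix_(k, j) c k j.+1.
pose T : 'M[R]_5 := \matrix_(j, k) (t * gdiag j.+1 * c k j.+1).
have MT : M *m T = 1%:M.
  apply/matrixP => i j; rewrite !mxE -c_orth gC_sum mulr_sumr.
  by apply: eq_bigr => k _; rewrite !mxE; ring.
have /matrixP/(_ a b) := mulmx1C MT.
by rewrite !mxE => <-; apply: eq_bigr => k _; rewrite !mxE.
Qed.

(** By completeness a vector is the sum of its inner products with the frame times the frame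
    vectors, so these inner products determine it. *)
Lemma orthonormal_nondeg u v : (forall k, gC u (c k) = gC v (c k)) ->
  forall i, (0 < i < 6)%N -> u i = v i.
Proof.
move=> uv i hi.
have H (w : nat -> R) (a : 'I_5) : w a.+1 = \sum_k t * c k a.+1 * gC w (c k).
  transitivity (\sum_b (b == a)%:R * w b.+1).
    rewrite (bigD1 a) //= eqxx mul1r big1 ?addr0 // => b /negPf ->.
    by rewrite mul0r.
  under [RHS]eq_bigr do rewrite gC_sum mulr_sumr.
  rewrite exchange_big; apply: eq_bigr => b _.
  rewrite -orthonormal_dual mulr_suml; apply: eq_bigr => k _; ring.
case: i hi => // n hn; have n5 : (n < 5)%N by [].
by rewrite -[n]/(val (Ordinal n5)) !H; apply: eq_bigr => k _; rewrite uv.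
Qed.

(** A metric trace does not depend on the frame: after expansion in e_1, ..., e_5, completeness
    kills the off-diagonal terms and turns the diagonal ones into the weights 1 / (t g(e_a, e_a)) of
    [covC_trace]. *)
Lemma covC_orthonormal_trace v w : \sum_k covC p q (c k) (c k) v w = 0.
Proof.
transitivity (t^-1 *
    \sum_(1 <= a < 6) covC p q (delta a) (delta a) v w / gdiag a).
  rewrite big_add1 big_mkord mulr_sumr.
  under eq_bigr do rewrite covC_expand // big_add1 big_mkord.
  rewrite exchange_big; apply: eq_bigr => a _ /=.
  have gn0 : gdiag a.+1 != 0 by apply: gdiag_neq0 => //; exact: (ltn_ord a).
  under eq_bigr do rewrite big_add1 big_mkord.
  rewrite exchange_big (bigD1 a) //= [X in _ + X]big1 ?addr0; last first.
    move=> b /negPf ba; rewrite -mulr_suml.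
    have := orthonormal_dual a b; rewrite eq_sym ba.
    under eq_bigr do rewrite -mulrA.
    rewrite -mulr_sumr => /eqP; rewrite !mulf_eq0 (negPf t_neq0) (negPf gn0) /=.
    by move/eqP ->; rewrite mul0r.
  rewrite -mulr_suml.
  have := orthonormal_dual a a; rewrite eqxx.
  under eq_bigr do rewrite -mulrA.
  rewrite -mulr_sumr => h.
  have -> : \sum_i c i a.+1 * c i a.+1 = (t * gdiag a.+1)^-1.
    apply: (mulfI (x := t * gdiag a.+1)).
      by rewrite mulf_neq0.
    by rewrite h mulfV // mulf_neq0.
  by rewrite invfM; ring.
by rewrite covC_trace // mulr0.
Qed.
End Orthonormal.

(** * Covariant derivatives of vector fields *)

Section Fields.
Context {R : realType} (p q : nat).
Hypotheses (p_gt0 : (0 < p)%N) (q_gt0 : (0 < q)%N).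
Local Notation A := (amb R).
Local Notation cf := (@coframe R p q).
Local Notation gC := (@gC R p q).
Local Notation hC := (@hC R p q).
Local Notation brk := (@bracket_m R p q).
Implicit Types (X Y Z W : A -> A) (x : A).

Lemma ginv_is_linear : linear (@ginv R).
Proof. by move=> k u v; congr pair; rewrite /= linearP. Qed.

HB.instance Definition _ :=
  GRing.isLinear.Build R A A _ (@ginv R) ginv_is_linear.

Definition lcoord X x (i : nat) : R := cf i (ginv x * X x).

Definition dcoord X Y x (i : nat) : R := cf i (ginv x * 'd Y x (X x)).

(* The product leaves su(2) + su(2), where [coframe] is a linear form without
   geometric meaning; only differences as in [pcoord_bracket] are known. *)
Definition pcoord X Y x (i : nat) : R := cf i (ginv x * X x * (ginv x * Y x)).

Lemma pcoord_bracket X Y x i :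
  vfield p q X -> vfield p q Y -> G x -> (0 < i < 6)%N ->
  pcoord X Y x i = pcoord Y X x i + brk i (lcoord X x) (lcoord Y x).
Proof. by move=> [_ mX _] [_ mY _] Gx hi; apply: coframe_bracket; auto. Qed.

Lemma vfield_lift X x : G x -> X x = x * (ginv x * X x).
Proof. by move=> Gx; rewrite mulrA (ginvV Gx).2 mul1r. Qed.

Lemma ginv_m (v : A) : v \in m_space p q -> ginv v = - v.
Proof. by move=> /(m_spaceE q_gt0) ->; exact: ginv_imag. Qed.

(** Write xi = x^-1 X(x), in m. As [ginv] is linear and sends xi to -xi, its derivative along X is
    -xi x^-1; the Leibniz rule for x^-1 Y gives the correction [pcoord]. *)
Lemma has_diff_coord X Y x i : vfield p q X -> vfield p q Y -> G x ->
  has_diff x (X x) (fun y => lcoord Y y i) (dcoord X Y x i - pcoord X Y x i).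
Proof.
move=> [_ mX _] [sY _ _] Gx.
have [Yd _] := sY 1%N.
have gD : is_diff x (@ginv R) (@ginv R).
  exact: (is_diff_linear (l := @ginv R) x
    (@amb_linear_continuous R A (@ginv R))).
have YD : is_diff x Y ('d Y x) by apply: DiffDef; [exact: Yd | exact: erefl].
have MD := is_diff_amb_mul gD YD.
have md := @ex_diff _ _ _ _ _ _ _ MD.
have mv := @diff_val _ _ _ _ _ _ _ MD.
have lc : continuous (cf i) := @amb_linear_continuous R _ (cf i).
have ld y : differentiable (cf i) y by exact: linear_differentiable.
split; first exact: (differentiable_comp md (ld _)).
rewrite (diff_comp md (ld _)) /= diff_lin // mv.
rewrite /lcoord /dcoord /pcoord -raddfB /=.
congr (cf i _); congr (_ + _).
rewrite {1}(vfield_lift X Gx) ginvM ginv_m; last exact: mX.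
by rewrite mulNr mulrA mulNr -mulrA.
Qed.

Lemma det_3 (S : comNzRingType) (M : 'M[S]_3) :
  \det M = M 0 0 * (M 1 1 * M 2 2 - M 2 1 * M 1 2)
         - M 0 1 * (M 1 0 * M 2 2 - M 2 0 * M 1 2)
         + M 0 2 * (M 1 0 * M 2 1 - M 2 0 * M 1 1).
Proof.
rewrite (expand_det_row _ 0) !big_ord_recl big_ord0 addr0 /cofactor !det_2.
rewrite !mxE /=.
have e00 : lift ord0 ord0 = 1 :> 'I_3 by exact/val_inj.
have e1 : lift ord0 (lift ord0 ord0) = 2 :> 'I_3 by exact/val_inj.
have f00 : lift 0 0 = 1 :> 'I_3 by exact/val_inj.
have f01 : lift 0 1 = 2 :> 'I_3 by exact/val_inj.
have f10 : lift 1 0 = 0 :> 'I_3 by exact/val_inj.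
have f11 : lift 1 1 = 2 :> 'I_3 by exact/val_inj.
have f20 : lift 2 0 = 0 :> 'I_3 by exact/val_inj.
have f21 : lift 2 1 = 1 :> 'I_3 by exact/val_inj.
rewrite -[ord0]/(0 : 'I_3) -?[ord0]/(0 : 'I_2).
rewrite ?e1 ?e00 ?f00 ?f01 ?f10 ?f11 ?f20 ?f21 /=.
rewrite !expr1 !expr2; ring.
Qed.

Lemma H_oE u v w : H_o p q u v w = hC (cf ^~ u) (cf ^~ v) (cf ^~ w).
Proof. by rewrite /H_o /wedge3 !det_3 !mxE /hC /=; ring. Qed.

Section Scaled.
Variable t : R.
Hypothesis t_neq0 : t != 0.
Let g := fun u v : A => t * g_o p q u v.
Let H := fun u v w : A => t * H_o p q u v w.

Lemma ev2E X Y x : ev2 g X Y x = t * gC (lcoord X x) (lcoord Y x).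
Proof. by []. Qed.

Lemma ev3E X Y Z x :
  ev3 H X Y Z x = t * hC (lcoord X x) (lcoord Y x) (lcoord Z x).
Proof. by rewrite /ev3 /H H_oE. Qed.

Definition lderiv X Y x i := dcoord X Y x i - pcoord X Y x i.

Lemma deriv_ev2 X Y Z x : vfield p q X -> vfield p q Y -> vfield p q Z -> G x ->
  Defs.deriv X (ev2 g Y Z) x =
  t * (gC (lderiv X Y x) (lcoord Z x) + gC (lcoord Y x) (lderiv X Z x)).
Proof.
move=> vX vY vZ Gx.
have C (c : R) : has_diff x (X x) (fun=> c) 0 by exact: has_diff_cst.
have DY i := has_diff_coord i vX vY Gx.
have DZ i := has_diff_coord i vX vZ Gx.
suff [] : has_diff x (X x) (ev2 g Y Z) (t * (gC (lderiv X Y x) (lcoord Z x)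
   + gC (lcoord Y x) (lderiv X Z x))) by [].
rewrite (_ : ev2 g Y Z = fun y => t * gC (lcoord Y y) (lcoord Z y)) // /gC.
apply: has_diff_eq.
  by repeat (first [exact: C | exact: DY | exact: DZ
     | apply: has_diffM | apply: has_diffD]).
rewrite /gC /lderiv; cbv beta.
move: (lcoord Y x) (lcoord Z x) (dcoord X Y x) (pcoord X Y x)
  (dcoord X Z x) (pcoord X Z x) => *; ring.
Qed.

Lemma deriv_ev3 X Y Z W x : vfield p q X -> vfield p q Y -> vfield p q Z ->
  vfield p q W -> G x ->
  Defs.deriv X (ev3 H Y Z W) x =
  t * (hC (lderiv X Y x) (lcoord Z x) (lcoord W x)
     + hC (lcoord Y x) (lderiv X Z x) (lcoord W x)
     + hC (lcoord Y x) (lcoord Z x) (lderiv X W x)).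
Proof.
move=> vX vY vZ vW Gx.
have C (c : R) : has_diff x (X x) (fun=> c) 0 by exact: has_diff_cst.
have DY i := has_diff_coord i vX vY Gx.
have DZ i := has_diff_coord i vX vZ Gx.
have DW i := has_diff_coord i vX vW Gx.
suff [] : has_diff x (X x) (ev3 H Y Z W)
  (t * (hC (lderiv X Y x) (lcoord Z x) (lcoord W x)
     + hC (lcoord Y x) (lderiv X Z x) (lcoord W x)
     + hC (lcoord Y x) (lcoord Z x) (lderiv X W x))) by [].
rewrite (_ : ev3 H Y Z W =
    fun y => t * hC (lcoord Y y) (lcoord Z y) (lcoord W y)); last first.
  by apply/funext => y; exact: ev3E.
rewrite /hC; apply: has_diff_eq.
  by repeat (first [exact: C | exact: DY | exact: DZ | exact: DW
     | apply: has_diffM | apply: has_diffB | apply: has_diffD]).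
rewrite /hC /lderiv; cbv beta.
move: (lcoord Y x) (lcoord Z x) (lcoord W x) (dcoord X Y x) (pcoord X Y x)
  (dcoord X Z x) (pcoord X Z x) (dcoord X W x) (pcoord X W x) => *; ring.
Qed.

Lemma lcoord_lie X Y x i : G x -> (0 < i < 6)%N ->
  lcoord (lie p q X Y) x i = dcoord X Y x i - dcoord Y X x i.
Proof.
move=> Gx hi; rewrite /lcoord /lie mulrA (ginvV Gx).1 mul1r coframe_pr_m //.
by rewrite mulrBr raddfB.
Qed.

(* [cov_congr] and [alt_congr] stand in for rewriting, during which unification
   would unfold the differentials. *)
Lemma cov_congr (a b c d a' b' c' d' : R) :
  a = a' -> b = b' -> c = c' -> d = d' ->
  a - b - c - d = a' - b' - c' - d'.
Proof. by move=> -> -> -> ->. Qed.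

Lemma alt_congr (a b c d e f h k l m a' b' c' d' e' f' h' k' l' m' : R) :
  a = a' -> b = b' -> c = c' -> d = d' -> e = e' -> f = f' -> h = h' ->
  k = k' -> l = l' -> m = m' ->
  a' - b' + c' - d' - e' + f' - h' - k' + l' - m' = 0 ->
  a - b + c - d - e + f - h - k + l - m = 0.
Proof. by do 10 move=> ->. Qed.

Lemma closed_H : closed3 p q H.
Proof.
move=> X Y Z W vX vY vZ vW x Gx; rewrite /dform3.
apply: (alt_congr (deriv_ev3 vX vY vZ vW Gx) (deriv_ev3 vY vX vZ vW Gx)
  (deriv_ev3 vZ vX vY vW Gx) (deriv_ev3 vW vX vY vZ Gx)
  (ev3E _ _ _ _) (ev3E _ _ _ _) (ev3E _ _ _ _)
  (ev3E _ _ _ _) (ev3E _ _ _ _) (ev3E _ _ _ _)).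
(* The hypotheses of [closed_alg] range over all indices; the default value [X] makes every [F n] a
   horizontal lift. *)
pose F n := nth X [:: X; Y; Z; W] n.
have vF n : vfield p q (F n).
  by case: n => [|[|[|[|n]]]] //=; rewrite /F nth_default.
have := @closed_alg R p q q_gt0 t (fun n => lcoord (F n) x)
  (fun m n => dcoord (F m) (F n) x) (fun m n => pcoord (F m) (F n) x)
  (fun m n => lcoord (lie p q (F m) (F n)) x)
  (fun m n i => @lcoord_lie (F m) (F n) x i Gx)
  (fun m n i => @pcoord_bracket (F m) (F n) x i (vF m) (vF n) Gx).
by [].
Qed.

(** * The Levi-Civita and Bismut connections in coordinates *)

Section LeviCivita.
Variable D : (A -> A) -> (A -> A) -> A -> A.
Hypothesis LC : levi_civita p q g D.

Lemma lcoord_torsion X Y x i : vfield p q X -> vfield p q Y -> G x ->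
  (0 < i < 6)%N ->
  lcoord (D X Y) x i - lcoord (D Y X) x i = dcoord X Y x i - dcoord Y X x i.
Proof.
move=> vX vY Gx hi; case: LC => _ /(_ X Y vX vY x Gx) T.
by rewrite -(lcoord_lie X Y Gx hi) /lcoord -T mulrBr raddfB.
Qed.

Lemma gC_metric X Y Z x : vfield p q X -> vfield p q Y -> vfield p q Z -> G x ->
  gC (lderiv X Y x) (lcoord Z x) + gC (lcoord Y x) (lderiv X Z x) =
  gC (lcoord (D X Y) x) (lcoord Z x) + gC (lcoord Y x) (lcoord (D X Z) x).
Proof.
move=> vX vY vZ Gx; case: LC => -[_ /(_ X Y Z vX vY vZ x Gx) M] _.
apply: (mulfI t_neq0); apply: (etrans (esym (deriv_ev2 vX vY vZ Gx))).
by apply: (etrans M); rewrite [RHS]mulrDr.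
Qed.

Lemma koszul X Y Z x : vfield p q X -> vfield p q Y -> vfield p q Z -> G x ->
  gC (lcoord (D X Y) x) (lcoord Z x) =
  gC (fun i => dcoord X Y x i - (pcoord X Y x i + pcoord Y X x i) / 2
      + symC p q i (lcoord X x) (lcoord Y x)) (lcoord Z x).
Proof.
move=> vX vY vZ Gx.
pose F n := nth X [:: X; Y; Z] n.
have vF n : vfield p q (F n).
  by case: n => [|[|[|n]]] //=; rewrite /F nth_default.
exact: (@koszul_alg R p q p_gt0 q_gt0 (fun n => lcoord (F n) x)
  (fun m n => lcoord (D (F m) (F n)) x) (fun m n => dcoord (F m) (F n) x)
  (fun m n => pcoord (F m) (F n) x)
  (fun m n i => @lcoord_torsion (F m) (F n) x i (vF m) (vF n) Gx)
  (fun m n i => @pcoord_bracket (F m) (F n) x i (vF m) (vF n) Gx)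
  (fun m n k => @gC_metric (F m) (F n) (F k) x (vF m) (vF n) (vF k) Gx)).
Qed.

Section Spanning.
Variables (x : A) (E : 'I_5 -> A -> A).
Hypotheses (Gx : G x) (vE : forall k, vfield p q (E k)).
(** The fields [E k] need only detect vectors of m at the one point [x]. Orthonormal frames do so,
    and so do the lifts of fundamental fields at the identity. *)
Hypothesis E_span : forall u v : nat -> R,
  (forall k, gC u (lcoord (E k) x) = gC v (lcoord (E k) x)) ->
  forall i, (0 < i < 6)%N -> u i = v i.

(** In Koszul's formula the symmetrised product differs from [pcoord X Y] by half a bracket, which
    is the bracket term of [nablaC]. *)
Lemma lcoord_levi_civita X Y i :
  vfield p q X -> vfield p q Y -> (0 < i < 6)%N ->
  lcoord (D X Y) x i = lderiv X Y x i + nablaC p q i (lcoord X x) (lcoord Y x).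
Proof.
move=> vX vY hi.
rewrite (E_span (fun k => koszul vX vY (vE k) Gx) hi) /lderiv /nablaC.
rewrite (pcoord_bracket vX vY Gx hi).
move: (dcoord _ _ _ _) (pcoord _ _ _ _) (symC _ _ _ _ _) (bracket_m _ _ _ _ _).
move=> a b c d.
by field.
Qed.

Lemma cov3_levi_civita X Y Z W : vfield p q X -> vfield p q Y -> vfield p q Z ->
  vfield p q W ->
  cov3 D H X Y Z W x =
  - t * covC p q (lcoord X x) (lcoord Y x) (lcoord Z x) (lcoord W x).
Proof.
move=> vX vY vZ vW.
pose F n := nth X [:: X; Y; Z; W] n.
have vF n : vfield p q (F n).
  by case: n => [|[|[|[|n]]]] //=; rewrite /F nth_default.
apply: etrans (@cov_alg R p q t (fun n => lcoord (F n) x)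
  (fun n => lderiv X (F n) x) (fun n => lcoord (D X (F n)) x)
  (@nablaC R p q) _); last first.
  by move=> n i hi; exact: lcoord_levi_civita.
exact: (cov_congr (deriv_ev3 vX vY vZ vW Gx)
  (ev3E _ _ _ _) (ev3E _ _ _ _) (ev3E _ _ _ _)).
Qed.

Variable B : (A -> A) -> (A -> A) -> A -> A.
Hypothesis HB : bismut p q g H D B.

(** The factor [t] is common to the metric and the 3-form, so it cancels and the extra term is
    [sharpC] for every scale. *)
Lemma lcoord_bismut X Y i : vfield p q X -> vfield p q Y -> (0 < i < 6)%N ->
  lcoord (B X Y) x i = lderiv X Y x i +
    (nablaC p q i (lcoord X x) (lcoord Y x)
     + sharpC p q i (lcoord X x) (lcoord Y x)).
Proof.
move=> vX vY hi; rewrite addrA -(lcoord_levi_civita vX vY hi).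
pose S i := sharpC p q i (lcoord X x) (lcoord Y x).
apply: (E_span (u := lcoord (B X Y) x)
  (v := fun i => lcoord (D X Y) x i + S i) _ hi) => k.
have -> : gC (fun i => lcoord (D X Y) x i + S i) (lcoord (E k) x) =
    gC (lcoord (D X Y) x) (lcoord (E k) x) + gC S (lcoord (E k) x).
  by rewrite /gC; move: (lcoord _ _) (lcoord _ _) S => a b c; ring.
rewrite gC_sharp //; apply: (mulfI t_neq0).
case: HB => _ /(_ X Y (E k) vX vY (vE k) x Gx) M.
apply: (etrans M); rewrite ev3E [ev2 _ _ _ _]ev2E.
by field.
Qed.

Lemma cov3_bismut X Y Z W : vfield p q X -> vfield p q Y -> vfield p q Z ->
  vfield p q W ->
  let L i u v := nablaC p q i u v + sharpC p q i u v in
  cov3 B H X Y Z W x =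
  - t * (hC (fun i => L i (lcoord X x) (lcoord Y x)) (lcoord Z x) (lcoord W x)
       + hC (lcoord Y x) (fun i => L i (lcoord X x) (lcoord Z x)) (lcoord W x)
       + hC (lcoord Y x) (lcoord Z x) (fun i => L i (lcoord X x) (lcoord W x))).
Proof.
move=> vX vY vZ vW L.
pose F n := nth X [:: X; Y; Z; W] n.
have vF n : vfield p q (F n).
  by case: n => [|[|[|[|n]]]] //=; rewrite /F nth_default.
apply: etrans (@cov_alg R p q t (fun n => lcoord (F n) x)
  (fun n => lderiv X (F n) x) (fun n => lcoord (B X (F n)) x) L _); last first.
  by move=> n i hi; exact: lcoord_bismut.
exact: (cov_congr (deriv_ev3 vX vY vZ vW Gx)
  (ev3E _ _ _ _) (ev3E _ _ _ _) (ev3E _ _ _ _)).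
Qed.

End Spanning.

Lemma coclosed_H : coclosed3 p q g D H.
Proof.
move=> x E Y Z Gx vE orth vY vZ.
have c_orth i j : t * gC (lcoord (E i) x) (lcoord (E j) x) = (i == j)%:R.
  exact: orth.
have span := orthonormal_nondeg c_orth.
apply/eqP; rewrite oppr_eq0; apply/eqP.
transitivity (\sum_k - t *
    covC p q (lcoord (E k) x) (lcoord (E k) x) (lcoord Y x) (lcoord Z x)).
  apply: eq_bigr => k _.
  exact: (cov3_levi_civita Gx vE span (vE k) (vE k) vY vZ).
rewrite -mulr_sumr.
by rewrite (covC_orthonormal_trace p_gt0 q_gt0 t_neq0 c_orth) mulr0.
Qed.
End LeviCivita.
End Scaled.
End Fields.

(** * Lifts of fundamental vector fields *)

Section Killing.
Context {R : realType} (p q : nat).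
Hypotheses (p_gt0 : (0 < p)%N) (q_gt0 : (0 < q)%N).
Local Notation A := (amb R).

(** The fundamental field of [a] on G is a x = x (x^-1 a x); projecting x^-1 a x onto m gives the
    horizontal lift of the field induced on G/K. Such lifts are globally defined and take any
    prescribed value at the base point. *)
Definition killing (a : A) (x : A) : A := x * pr_m p q (ginv x * a * x).

Lemma pr_m_is_linear : linear (@pr_m R p q).
Proof.
move=> k u v; rewrite /pr_m scaler_sumr -big_split; apply: eq_bigr => i _.
by rewrite linearP scalerDl scalerA.
Qed.

HB.instance Definition _ :=
  GRing.isLinear.Build R A A _ (@pr_m R p q) pr_m_is_linear.

Lemma vfield_killing u : vfield p q (killing (mvec p q u)).
Proof.
split.
- move=> n; apply: ndiff_mul; first exact: ndiff_id.
  apply: (@ndiff_linear_comp R A A A n (@pr_m R p q)).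
    exact: amb_linear_continuous.
  apply: ndiff_mul; last exact: ndiff_id.
  apply: ndiff_mul; last exact: ndiff_cst.
  by apply: (@ndiff_linear R A A n (@ginv R)); exact: amb_linear_continuous.
- move=> x Gx; rewrite /killing mulrA (ginvV Gx).1 mul1r pr_mE; exact: mvec_in.
- move=> x k Gx Kk; rewrite /killing ginvM.
  (* The projection is known to be K-equivariant on imaginary elements, so x^-1 a x is first put in
     that form. *)
  have [d1 [d2 [d3 [d4 [d5 [d6 e]]]]]] := conj_imag
    (q%:R * u 1 / 2) (nEV * u 2) (nEV * u 3)
    (- (p%:R * u 1 / 2)) (nEV * u 4) (nEV * u 5) Gx.
  have -> : ginv k * ginv x * mvec p q u * (x * k) =
      ginv k * (ginv x * mvec p q u * x) * k.
    by rewrite !mulrA.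
  rewrite [in LHS]/mvec [in RHS]/mvec e -(mulrA x k) -(mulrA x (pr_m p q _)).
  by congr (x * _); exact: pr_m_K.
Qed.

Lemma lcoord_killing1 u i : (0 < i < 6)%N ->
  lcoord p q (killing (mvec p q u)) 1 i = u i.
Proof.
move=> hi; rewrite /lcoord /killing ginv1 !mul1r mulr1 coframe_pr_m //.
exact: coframe_mvec.
Qed.

End Killing.

(** * Harmonicity and failure of Bismut parallelism *)

Theorem mainTheorem6 (R : realType) (p q : nat) (t : R) :
  (1 <= q)%N -> (q <= p)%N -> coprime p q -> 0 < t ->
  let g := fun u v : amb R => t * g_o p q u v in
  let H := fun u v w : amb R => t * H_o p q u v w in
  forall D B : (amb R -> amb R) -> (amb R -> amb R) -> amb R -> amb R,
  levi_civita p q g D -> bismut p q g H D B ->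
  harmonic3 p q g D H /\ ~ parallel3 p q B H.
Proof.
move=> q_gt0 qp _ t_gt0 g H D B LC BI.
have p_gt0 : (0 < p)%N by exact: leq_trans qp.
have t_neq0 : t != 0 by rewrite gt_eqF.
split.
  by split; [exact: closed_H | exact: (coclosed_H p_gt0 q_gt0 t_neq0 LC)].
move=> par.
pose F k : amb R -> amb R := killing p q (mvec p q (delta k)).
pose E (k : 'I_5) := F k.+1.
have vF k : vfield p q (F k) by exact: vfield_killing.
have cF k i : (0 < i < 6)%N -> lcoord p q (F k) 1 i = delta k i.
  by move=> hi; exact: lcoord_killing1.
have span (u v : nat -> R) :
    (forall k, gC p q u (lcoord p q (E k) 1) = gC p q v (lcoord p q (E k) 1)) ->
    forall i, (0 < i < 6)%N -> u i = v i.
  move=> uv i hi; case: i hi => // n hn; have n5 : (n < 5)%N by [].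
  have := uv (Ordinal n5).
  have e w : gC p q w (lcoord p q (E (Ordinal n5)) 1) = gdiag p q n.+1 * w n.+1.
    rewrite (gC_ext p q (u' := w) (v' := delta n.+1)) //; last exact: cF.
    by rewrite gC_comm gC_deltal.
  by rewrite !e; apply: mulfI; exact: gdiag_neq0.
have := par _ _ _ _ (vF 2) (vF 3) (vF 4) (vF 5) 1 (@G1 R).
have E1 := cov3_bismut p_gt0 q_gt0 t_neq0 LC (@G1 R) (fun k => vF k.+1) span BI
  (vF 2) (vF 3) (vF 4) (vF 5).
have E2 := hC_bismut p_gt0 q_gt0 cF.
(* Parallelism would make - t p q / (2 (p^2 + q^2)) zero, whereas t, p and q are positive. *)
move=> E0; move: (etrans (esym E0) (etrans E1 (congr1 ( *%R (- t)) E2))).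
move/esym.
apply/eqP; rewrite mulf_neq0 ?oppr_eq0 //.
rewrite !mulf_neq0 ?invr_neq0 ?mulf_neq0 ?pnatr_eq0 -?lt0n //.
exact: sumsq_neq0.
Qed.
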